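(* For each integer $k\geq 3$ and each integer $r$ with $1\leq r\leq k-1$, there exists a graph $Q_{k,r}$ such that $\Gamma(Q_{k,r})=k$, $\gamma(Q_{k,r})=r$ and $d_0(Q_{k,r})=k+r=\Gamma(Q_{k,r})+\gamma(Q_{k,r})$.
   Context: All graphs are finite and simple. For a graph $G$, $\gamma(G)$ is the domination number (minimum cardinality of a dominating set) and $\Gamma(G)$ is the upper domination number (maximum cardinality of a minimal dominating set). For an integer $k$, the $k$-dominating graph $D_k(G)$ has as vertices the dominating sets of $G$ of cardinality at most $k$, two such sets being adjacent if and only if one can be obtained from the other by adding or deleting a single vertex of $G$. $d_0(G)$ denotes the smallest integer such that $D_k(G)$ is connected for all $k\geq d_0(G)$. *)

(* Defs.v *)
From mathcomp Require Import all_boot.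

Set Implicit Arguments.
Unset Strict Implicit.
Unset Printing Implicit Defensive.

Record sgraph := SGraph {
  svertex :> finType;
  sedge : rel svertex;
  sedge_sym : symmetric sedge;
  sedge_irr : irreflexive sedge
}.

(* The null graph does not count as connected. *)
Definition connected (G : sgraph) : Prop :=
  0 < #|G| /\ forall x y : G, connect (@sedge G) x y.

Definition dominating (G : sgraph) (D : {set G}) : bool :=
  [forall v, (v \in D) || [exists u in D, sedge u v]].

Definition gamma (G : sgraph) : nat :=
  #|[arg min_(D < [set: G] | dominating D) #|D|]|.

Definition Gamma (G : sgraph) : nat :=
  \max_(D : {set G} | minset (@dominating G) D) #|D|.

Definition Dk_vertex (G : sgraph) (k : nat) : finType :=
  {D : {set G} | dominating D && (#|D| <= k)}.

Definition Dk_adj (G : sgraph) (k : nat) : rel (Dk_vertex G k) :=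
  fun A B => [exists v, (v \notin val A) && (val B == v |: val A)]
          || [exists v, (v \in val A) && (val B == val A :\ v)].

Lemma Dk_adj_sym (G : sgraph) (k : nat) : symmetric (@Dk_adj G k).
Proof.
suff sub A B : @Dk_adj G k A B -> Dk_adj B A by move=> A B; apply/idP/idP; exact: sub.
case/orP => /existsP[v /andP[vA /eqP eB]]; apply/orP; [right | left];
  apply/existsP; exists v; rewrite eB.
- by rewrite setU11 setU1K ?eqxx.
- by rewrite setD11 setD1K ?eqxx.
Qed.

Lemma Dk_adj_irr (G : sgraph) (k : nat) : irreflexive (@Dk_adj G k).
Proof.
move=> A; apply/negP => /orP[] /existsP[v /andP[vA /eqP eA]].
- by rewrite eA setU11 in vA.
- by rewrite eA setD11 in vA.
Qed.

Definition Dk (G : sgraph) (k : nat) : sgraph :=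
  SGraph (@Dk_adj_sym G k) (@Dk_adj_irr G k).

Definition connected_from (G : sgraph) (d : nat) : Prop :=
  forall k, d <= k -> connected (Dk G k).

(* [is_d0 G d] says d_0(G) = d. Naturals suffice: for k < 0 no set has
   cardinality at most k, so D_k(G) is null and hence not connected. *)
Definition is_d0 (G : sgraph) (d : nat) : Prop :=
  connected_from G d /\ forall d', connected_from G d' -> d <= d'.

(* Main.v *)
(** Take vertices [a_j], [u_i], [z], [p_ij] with [i < r], [j < k].  The [a]'s,
    the [u]'s and [z] form a clique [K], each row [{u_i} + {p_ij | j}] is a
    clique, and [a_j] is adjacent to every [p_ij].  As [N[z] = K] and [N[p_ij]]
    is row [i] together with [a_j], a set dominates if and only if it contains
    [A = {a_j}] or meets [K] and every row.  Hence the minimal dominating sets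
    are [A] and sets of size at most [r + 1 <= k], and the [u]'s form a minimum
    dominating set.  Before a path starting at [A] can drop its first [a_j] it
    must meet all [r] rows, which are disjoint from [A], so it passes through a
    set of size [k + r].  Conversely, in any graph, from a minimal dominating
    set one can add a whole minimum dominating set and then shrink to it, using
    at most [Gamma + gamma] vertices. *)
Require Import Defs.
From mathcomp Require Import all_boot.

Set Implicit Arguments.
Unset Strict Implicit.
Unset Printing Implicit Defensive.

(** * Domination in arbitrary graphs and the upper bound on $d_0$ *)

Section DominatingSets.

Variable G : sgraph.
Implicit Types D E : {set G}.

Lemma dominatingP D :
  reflect (forall v, exists2 u, u \in D & (u == v) || sedge u v)
          (dominating D).
Proof.
apply: (iffP forallP) => [domD v | domD v].
  case/orP: (domD v) => [vD | /exists_inP[u uD uv]]; first by exists v; rewrite ?eqxx.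
  by exists u; rewrite // uv orbT.
have [u uD /orP[/eqP<- | uv]] := domD v; first by rewrite uD.
by apply/orP; right; apply/exists_inP; exists u.
Qed.

Lemma dominatingS D E : D \subset E -> dominating D -> dominating E.
Proof.
move=> /subsetP DE /dominatingP domD; apply/dominatingP => v.
by have [u /DE uE uv] := domD v; exists u.
Qed.

Lemma dominatingT : @dominating G setT.
Proof. by apply/dominatingP => v; exists v; rewrite ?inE ?eqxx. Qed.

Lemma gamma_attained : exists2 D : {set G}, dominating D & #|D| = gamma G.
Proof.
by rewrite /gamma; case: arg_minnP => [|D domD _]; [exact: dominatingT | exists D].
Qed.

Lemma gamma_le D : dominating D -> gamma G <= #|D|.
Proof.
by move=> domD; rewrite /gamma; case: arg_minnP => [|E _]; [exact: dominatingT | apply].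
Qed.

Lemma Gamma_ge D : minset (@dominating G) D -> #|D| <= Gamma G.
Proof. by move=> minD; rewrite /Gamma (bigD1 D) //= leq_maxl. Qed.

(** Deleting the vertices of [X] outside [Y] one at a time always leaves a superset of [Y], hence a
    dominating set, and the size only decreases. *)
Lemma Dk_connect_sub (n : nat) (X Y : Dk G n) :
  val Y \subset val X -> connect (@sedge (Dk G n)) X Y.
Proof.
have [m] := ubnP #|val X|; elim: m => // m IHm in X *; rewrite ltnS => leXm YX.
have [eXY | neXY] := eqVneq (val X) (val Y).
  by rewrite (val_inj eXY) connect0.
have /properP[_ [v vX vY]] : val Y \proper val X.
  by rewrite properEneq eq_sym neXY.
have YXv : val Y \subset val X :\ v by rewrite subsetD1 YX vY.
have ltXv : #|val X :\ v| < #|val X| by rewrite [X in _ < X](cardsD1 v) vX.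
have domXv : dominating (val X :\ v) && (#|val X :\ v| <= n).
  have /andP[domY _] := valP Y; have /andP[_ leXn] := valP X.
  by rewrite (dominatingS YXv domY) (leq_trans (ltnW ltXv)).
pose Z : Dk G n := Sub (val X :\ v) domXv.
apply: (@connect_trans _ _ Z); last first.
  by apply: IHm => //=; exact: leq_trans ltXv leXm.
apply: connect1; apply/orP; right; apply/existsP; exists v.
by rewrite vX /= eqxx.
Qed.

Lemma Dk_connect_sym (n : nat) : connect_sym (@sedge (Dk G n)).
Proof. exact: sym_connect_sym (sedge_sym (s := Dk G n)). Qed.

Lemma connected_from_Gamma_gamma : connected_from G (Gamma G + gamma G).
Proof.
move=> n le_n; have [R domR cardR] := gamma_attained.
have domRn : dominating R && (#|R| <= n).
  by rewrite domR cardR (leq_trans (leq_addl _ _) le_n).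
pose R' : Dk G n := Sub R domRn.
(* The route is [X], [M], [M :|: R], [R]. Shrinking to a minimal [M] first keeps the union within
   [Gamma G + gamma G]. *)
have toR X : connect (@sedge (Dk G n)) X R'.
  have /andP[domX leXn] := valP X.
  have [M minM MX] := minset_exists (P := @dominating G) domX.
  have domM := minsetp minM.
  have leMR : #|M :|: R| <= n.
    apply: leq_trans le_n; apply: leq_trans (leq_card_setU M R) _.
    by rewrite cardR leq_add2r Gamma_ge.
  have leMn : dominating M && (#|M| <= n).
    by rewrite domM (leq_trans (subset_leq_card MX)).
  have domMR : dominating (M :|: R) && (#|M :|: R| <= n).
    by rewrite leMR (dominatingS (subsetUl M R)).
  apply: (@connect_trans _ _ (Sub M leMn : Dk G n)); first exact: Dk_connect_sub.
  apply: (@connect_trans _ _ (Sub (M :|: R) domMR : Dk G n)).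
    by rewrite Dk_connect_sym; apply: Dk_connect_sub; exact: subsetUl.
  by apply: Dk_connect_sub; exact: subsetUr.
split; first by apply/card_gt0P; exists R'.
by move=> X Y; apply: connect_trans (toR X) _; rewrite Dk_connect_sym.
Qed.

End DominatingSets.

(** * The graph [Q] and its dominating sets *)

Section Construction.

Variables r k : nat.

(* [a_j = (None, Some j)], [u_i = (Some i, None)], [z = (None, None)] and
   [p_ij = (Some i, Some j)]. *)
Definition Qvertex : finType := (option 'I_r * option 'I_k)%type.

Definition inK (x : Qvertex) := (x.1 == None) || (x.2 == None).

(** The first disjunct gives the row cliques and the third joins [a_j] to [p_ij]. The other pairs
    they admit, among the [a_j] and [z] or between [z] and [u_i], already lie in the clique [K]. *)
Definition Qedge : rel Qvertex := fun x y =>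
  (x != y) && [|| x.1 == y.1, inK x && inK y |
                  (x.2 == y.2) && ((x.1 == None) || (y.1 == None))].

Lemma Qedge_sym : symmetric Qedge.
Proof.
move=> x y; rewrite /Qedge eq_sym [x.1 == _]eq_sym [x.2 == _]eq_sym.
by rewrite [inK x && _]andbC [(x.1 == _) || _]orbC.
Qed.

Lemma Qedge_irr : irreflexive Qedge.
Proof. by move=> x; rewrite /Qedge eqxx. Qed.

Definition Q : sgraph := SGraph Qedge_sym Qedge_irr.

Implicit Types D : {set Q}.

Definition setA : {set Q} := [set ((None, Some j) : Qvertex) | j : 'I_k].
Definition setU : {set Q} := [set ((Some i, None) : Qvertex) | i : 'I_r].

(** Here [j] ranges over [option 'I_k], so [u_i] counts as a member of row [i]. *)
Definition meets_rows D := forall i, exists j, ((Some i, j) : Qvertex) \in D.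

Lemma card_setA : #|setA| = k.
Proof. by rewrite card_imset ?card_ord // => i j []. Qed.

Lemma card_setU : #|setU| = r.
Proof. by rewrite card_imset ?card_ord // => i j []. Qed.

Lemma Q_nbr_z (u : Q) : (u == (None, None)) || sedge u ((None, None) : Qvertex) = inK u.
Proof. by case: u => [[i|] [j|]]; rewrite /= /Qedge /inK /= ?xpair_eqE ?eqxx. Qed.

Lemma Q_nbr_p (u : Q) i j :
  (u == (Some i, Some j)) || sedge u ((Some i, Some j) : Qvertex)
    = (u.1 == Some i) || (u == (None, Some j)).
Proof.
case: u => [[i'|] [j'|]]; rewrite /= /Qedge /inK /= ?xpair_eqE ?eqxx //=;
  by do ?case: eqP => //=.
Qed.

Lemma Q_nbr_K (u v : Q) : inK u -> inK v -> (u == v) || sedge u v.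
Proof. by rewrite /= /Qedge; case: eqP => //= _ -> ->; rewrite orbT. Qed.

Lemma dominating_rows D :
  (exists2 x, x \in D & inK x) -> meets_rows D -> dominating D.
Proof.
move=> [x xD xK] rowsD; apply/dominatingP => v.
have [vK | ] := boolP (inK v); first by exists x; rewrite ?Q_nbr_K.
case: v => [[i|] [j|]] // _; have [j' ijD] := rowsD i.
by exists (Some i, j'); rewrite // Q_nbr_p /= eqxx.
Qed.

Lemma dominating_meets_K D : dominating D -> exists2 x, x \in D & inK x.
Proof.
move/dominatingP=> /(_ ((None, None) : Qvertex))[u uD].
by rewrite Q_nbr_z; exists u.
Qed.

(** A single missing [a_j] serves for all rows: whatever dominates [p_ij] must then lie in row
    [i]. *)
Lemma dominating_meets_rows D :
  dominating D -> ~~ (setA \subset D) -> meets_rows D.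
Proof.
move=> /dominatingP domD /subsetPn[_ /imsetP[j _ ->] ajD] i.
have [[u1 u2] uD] := domD ((Some i, Some j) : Qvertex).
rewrite Q_nbr_p => /orP[/= /eqP eu | /eqP eu]; last by rewrite eu (negPf ajD) in uD.
by exists u2; rewrite -eu.
Qed.

(** The row vertices have first coordinate [Some i] and [setA] has only [None], so the projection of
    [D :\: setA] takes [r] distinct values. *)
Lemma card_meets_rows D : meets_rows D -> r <= #|D :\: setA|.
Proof.
move=> rowsD.
have sub : [set Some i | i : 'I_r] \subset [set (x : Qvertex).1 | x in D :\: setA].
  apply/subsetP => _ /imsetP[i _ ->]; have [j ijD] := rowsD i.
  apply/imsetP; exists ((Some i, j) : Qvertex) => //.
  by rewrite inE ijD andbT; apply/imsetP => -[].
have := leq_trans (subset_leq_card sub) (leq_imset_card _ _).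
by rewrite card_imset ?card_ord // => i j [].
Qed.

Lemma meets_rows_subset D :
  meets_rows D -> exists2 E : {set Q}, E \subset D & meets_rows E /\ #|E| <= r.
Proof.
move=> rowsD.
have rowsDb i : [exists j, ((Some i, j) : Qvertex) \in D] by apply/existsP.
pose f i : Qvertex := (Some i, xchoose (existsP (rowsDb i))).
exists [set f i | i : 'I_r].
  by apply/subsetP => _ /imsetP[i _ ->]; exact: xchooseP (existsP (rowsDb i)).
split=> [i|]; last by rewrite -[X in _ <= X]card_ord leq_imset_card.
by exists (f i).2; apply/imsetP; exists i.
Qed.

(** * The values of [Gamma] and [gamma] *)

Hypotheses (r_gt0 : 0 < r) (ltrk : r < k).

Lemma dominating_setA : dominating setA.
Proof.
have j0 : 'I_k := Ordinal (ltn_trans r_gt0 ltrk).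
have aA j : ((None, Some j) : Qvertex) \in setA by apply/imsetP; exists j.
apply/dominatingP => v; have [vK | ] := boolP (inK v).
  by exists ((None, Some j0) : Qvertex); rewrite ?Q_nbr_K.
case: v => [[i|] [j|]] // _; exists ((None, Some j) : Qvertex) => //.
by rewrite Q_nbr_p eqxx orbT.
Qed.

Lemma dominating_setU : dominating setU.
Proof.
have uU i : ((Some i, None) : Qvertex) \in setU by apply/imsetP; exists i.
apply: dominating_rows => [|i]; last by exists None.
by exists ((Some (Ordinal r_gt0), None) : Qvertex).
Qed.

Lemma minset_setA : minset (@dominating Q) setA.
Proof.
apply/minsetP; split=> [|D domD DA]; first exact: dominating_setA.
apply/eqP; rewrite eqEsubset DA /=; apply/negPn/negP => nAD.
(* A proper subset of [setA] that dominates would need [r > 0] vertices outside [setA]. *)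
have := card_meets_rows (dominating_meets_rows domD nAD).
by move: DA; rewrite -setD_eq0 => /eqP ->; rewrite cards0 leqNgt r_gt0.
Qed.

Lemma Q_Gamma : Gamma Q = k.
Proof.
apply/eqP; rewrite eqn_leq -[X in _ && (X <= _)]card_setA.
rewrite (Gamma_ge minset_setA) andbT; apply/bigmax_leqP => D minD.
have domD := minsetp minD.
have [AD | nAD] := boolP (setA \subset D).
  by rewrite -(minsetinf minD dominating_setA AD) card_setA.
have [x xD xK] := dominating_meets_K domD.
have [E ED [rowsE cardE]] := meets_rows_subset (dominating_meets_rows domD nAD).
(* Minimality forces [D = x |: E], of size at most [r + 1 <= k]; [x] may already lie in [E]. *)
have domE : dominating (x |: E).
  apply: dominating_rows => [|i]; first by exists x; rewrite ?setU11.
  by have [j ijE] := rowsE i; exists j; rewrite setU1r.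
have xED : x |: E \subset D by rewrite subUset sub1set xD.
rewrite -(minsetinf minD domE xED); apply: leq_trans ltrk.
by rewrite cardsU1 -[r.+1]add1n leq_add // leq_b1.
Qed.

Lemma Q_gamma : gamma Q = r.
Proof.
apply/eqP; rewrite eqn_leq -[X in _ <= X]card_setU (gamma_le dominating_setU) /=.
have [D domD <-] := gamma_attained Q.
have [AD | nAD] := boolP (setA \subset D).
  by rewrite (leq_trans (ltnW ltrk)) // -[X in X <= _]card_setA subset_leq_card.
apply: leq_trans (card_meets_rows (dominating_meets_rows domD nAD)) _.
exact/subset_leq_card/subsetDl.
Qed.

(** * The lower bound on $d_0$ *)

Lemma Dk_adj_supsetA (n : nat) (X Y : Dk Q n) :
  n < k + r -> sedge X Y -> setA \subset val X -> setA \subset val Y.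
Proof.
move=> ltn AdjXY AX; apply: contraLR ltn => nAY; rewrite -leqNgt.
have /andP[domY _] := valP Y; have /andP[_ leXn] := valP X.
case/orP: AdjXY => /existsP[v /andP[_ /eqP eY]].
  by rewrite eY subsetU ?AX ?orbT in nAY.
(* In the deletion case [X] contains all of [setA] and also the row vertices of [Y] outside it, at
   least [k + r] in total. *)
apply: leq_trans leXn; rewrite -(cardsID setA (val X)) (setIidPr AX) card_setA.
rewrite leq_add2l; apply: leq_trans (card_meets_rows (dominating_meets_rows domY nAY)) _.
by rewrite eY subset_leq_card // setSD // subsetDl.
Qed.

Lemma Q_disconnected (n : nat) : k <= n -> n < k + r -> ~ connected (Dk Q n).
Proof.
move=> lekn ltn [_ conn].
have domA : dominating setA && (#|setA| <= n) by rewrite dominating_setA card_setA.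
have domU : dominating setU && (#|setU| <= n).
  by rewrite dominating_setU card_setU (leq_trans (ltnW ltrk)).
(* The supersets of [setA] form a union of components, which contains [setA] but not the smaller
   [setU]. *)
have clA : closed (@sedge (Dk Q n)) [pred X : Dk Q n | setA \subset val X].
  move=> X Y XY; rewrite !inE; apply/idP/idP; apply: Dk_adj_supsetA => //.
  by rewrite sedge_sym.
have := closed_connect clA (conn (Sub setA domA) (Sub setU domU)).
rewrite !inE /= subxx => /esym /subset_leq_card.
by rewrite card_setA card_setU leqNgt ltrk.
Qed.

Lemma Q_d0 : is_d0 Q (k + r).
Proof.
split=> [|d conn].
  by have := @connected_from_Gamma_gamma Q; rewrite Q_Gamma Q_gamma.
rewrite leqNgt; apply/negP => ltd.
have kr_gt0 : 0 < k + r by rewrite addn_gt0 r_gt0 orbT.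
(* The bound [k + r - 1] is at least [d], and at least [k] because [r > 0]. *)
apply: (@Q_disconnected (k + r).-1); last by apply: conn; rewrite -ltnS prednK.
  by rewrite -ltnS prednK // -[X in X < _]addn0 ltn_add2l.
by rewrite prednK.
Qed.

End Construction.

Theorem theorem2 : forall k r : nat, 3 <= k -> 1 <= r <= k - 1 ->
  exists Q : sgraph,
    [/\ Gamma Q = k, gamma Q = r, is_d0 Q (k + r) & k + r = Gamma Q + gamma Q].
Proof.
move=> k r k_ge3 /andP[r_gt0 le_r].
have ltrk : r < k by case: k k_ge3 le_r => // k' _; rewrite subn1 ltnS.
by exists (Q r k); rewrite Q_Gamma // Q_gamma //; split=> //; exact: Q_d0.
Qed.
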